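(* The distance $d_{KB}$ is frame-indifferent, in the following sense. Consider the general change of frame (observer) $$\mathfrak t^*=\mathfrak t-\mathfrak t_0,\qquad x^*=c^*(\mathfrak t)+Q_{\mathfrak t}\,x,$$ where $\mathfrak t\in\mathbb R$ is the physical time, $x\in\mathbb R^d$, $\mathfrak t_0\in\mathbb R$, $c^*:\mathbb R\to\mathbb R^d$, and $Q_{\mathfrak t}$ is a time-dependent orthogonal $d\times d$ matrix. Let $T_0,T_1$ be positive-semidefinite-frame-indifferent-tensor-valued measures, i.e. for each physical time $\mathfrak t$ they are represented in the initial frame by elements $T_i(\mathfrak t,x)$ of $\mathbb P^+$ (as matrix measures in $x$), and their representations in the new frame are $$T_i^*(\mathfrak t^*,x^* )=Q_{\mathfrak t}\,T_i(\mathfrak t,x)\,Q_{\mathfrak t}^\top,\qquad i=0,1.$$ Then $$d_{KB}\big(T_0^*(\mathfrak t^*,x^* ),T_1^*(\mathfrak t^*,x^* )\big)=d_{KB}\big(T_0(\mathfrak t,x),T_1(\mathfrak t,x)\big).$$ In other words, $d_{KB}$ may be considered as a distance on positive-semidefinite-frame-indifferent-tensor-valued measures.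
   Context: $\mathcal S$ is the space of symmetric real $d\times d$ matrices, $\mathcal P^+\subset\mathcal S$ the positive-semidefinite ones, $A:B=\mathrm{Tr}(AB^\top)$, $A^{Sym}=\frac12(A+A^\top)$. $\mathbb P^+$ is the set of $\mathcal P^+$-valued Radon measures $G$ on $\mathbb R^d$ with finite mass $\mathrm{Tr}\,G(\mathbb R^d)$. For a matrix measure $G=g\,\mu$ with $\mu=\mathrm{Tr}\,G$, and vector fields $u,v$ and matrix fields $U,V$, write $\int \mathrm dG\,u\cdot v=\int gu\cdot v\,\mathrm d\mu$, $\int \mathrm dG\,U:V=\int (gU):V\,\mathrm d\mu$. $\mathcal C_w([0,1];\mathbb P^+)$ is the set of curves $t\mapsto G_t\in\mathbb P^+$ continuous for narrow convergence (convergence of $\int\phi\,\mathrm dG$ for all bounded continuous scalar $\phi$). Frames: a frame (observer) is a correspondence between the spatial points and the elements $x$ of $\mathbb R^d$, as well as between the moments of time and the elements $\mathfrak t$ of the scalar axis $\mathbb R$; the metrics in $\mathbb R^d$ and in the scalar axis and the time direction are assumed frame-invariant, so the change of coordinates in the claim is the most general one. A vector existing in the physical space irrespectively of the observer, represented by $w\in\mathbb R^d$ in the initial frame, is represented by $w^*=Q_{\mathfrak t}w$ in the new frame. A frame-indifferent tensor is a linear automorphism of such vectors; hence the two representations of a frame-indifferent tensor function are related by $T^*(\mathfrak t^*,x^* )=Q_{\mathfrak t}T(\mathfrak t,x)Q_{\mathfrak t}^\top$. The distance $d_{KB}$ is taken between matrix measures in the space variable ($x$ in the initial frame, $x^*$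 in the new one), at the physical time $\mathfrak t$ (respectively $\mathfrak t^*$); the physical time $\mathfrak t$ is unrelated to the path parameter $t\in[0,1]$ used below. For $G\in\mathcal C_w([0,1];\mathbb P^+)$, $L^2(0,1;L^2(\mathrm dG_t))$ is the Hilbert space obtained from $\mathcal C^1_b([0,1]\times\mathbb R^d;\mathcal S\times\mathbb R^d)$ ($\mathcal C^1$, bounded with bounded first derivatives) by quotienting by the kernel of, and completing with respect to, the seminorm $$\|\mathfrak U\|^2_{L^2(0,1;L^2(\mathrm dG_t))}=\int_0^1\Big(\int_{\mathbb R^d}\mathrm dG_t\,u_t\cdot u_t+\int_{\mathbb R^d}\mathrm dG_t\,U_t:U_t\Big)\mathrm dt,\qquad \mathfrak U=(U,u).$$ Its elements are rendered as pairs $\mathfrak U=(U,u)$ of an $\mathcal S$-valued and an $\mathbb R^d$-valued square-integrable field. The pair $(G_t,\mathfrak U_t)_{t\in[0,1]}$, $\mathfrak U_t=(U_t,u_t)$, belongs to the admissible set $\mathcal A(G_0,G_1)$ if $G\in\mathcal C_w([0,1];\mathbb P^+)$, $G|_{t=0}=G_0$, $G|_{t=1}=G_1$, $\mathfrak U\in L^2(0,1;L^2(\mathrm dG_t))$, and $\partial_tG_t=\{-\nabla(G_tu_t)+G_tU_t\}^{Sym}$ in the weak sense, i.e. $$\int_{\mathbb R^d}\Phi_t:\mathrm dG_t-\int_{\mathbb R^d}\Phi_s:\mathrm dG_s-\int_s^t\int_{\mathbb R^d}\mathrm dG_\tau:\partial_\tau\Phi_\tau\,\mathrm d\tau=\int_s^t\int_{\mathbb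 R^d}(\mathrm dG_\tau u_\tau\cdot\operatorname{div}\Phi_\tau+\mathrm dG_\tau U_\tau:\Phi_\tau)\,\mathrm d\tau$$ for all $\Phi\in\mathcal C^1_b([0,1]\times\mathbb R^d;\mathcal S)$ and $t,s\in[0,1]$ ($\operatorname{div}$ is the row-wise divergence). The Kantorovich-Bures distance on $\mathbb P^+$ is $d_{KB}(G_0,G_1)=\big(\inf_{\mathcal A(G_0,G_1)}\|\mathfrak U\|^2_{L^2(0,1;L^2(\mathrm dG_t))}\big)^{1/2}$. *)

(* Defs.v *)
From HB Require Import structures.
From mathcomp Require Import all_boot all_order all_algebra.
From mathcomp Require Import all_classical all_reals all_analysis.
Import numFieldNormedType.Exports.

Set Implicit Arguments.
Unset Strict Implicit.
Unset Printing Implicit Defensive.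

Import Order.TTheory GRing.Theory Num.Theory.

Local Open Scope classical_set_scope.
Local Open Scope ring_scope.

Section algebra.
Context {R : realType} {d : nat}.
Implicit Types (u v : 'cV[R]_d) (A B : 'M[R]_d).

Definition dotv u v : R := (u^T *m v) 0 0.

Definition ddot A B : R := \tr (A *m B^T).

Definition sym_mx A : Prop := A^T = A.

Definition psd_mx A : Prop := sym_mx A /\ forall v, 0 <= dotv (A *m v) v.

Definition orthogonal_mx A : Prop := A *m A^T = 1%:M.

End algebra.

(* R^d with its Borel sigma-algebra; the carrier is 'cV[R]_d itself. *)
Notation borelV R d := (g_sigma_algebraType (@open 'cV[R]_d)).

(* The space P^+. Charges are finite and countably additive, so the mass is
   finite, and finite Borel measures on R^d are automatically Radon. *)
Record psd_measure (R : realType) (d : nat) := PsdMeasure {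
  entry : 'I_d -> 'I_d -> {charge set (borelV R d) -> \bar R} ;
  entry_psd : forall A : set (borelV R d), measurable A ->
    psd_mx (\matrix_(i, j) fine (entry i j A)) }.

Definition pm_value (R : realType) (d : nat) (G : psd_measure R d)
    (A : set (borelV R d)) : 'M[R]_d :=
  \matrix_(i, j) fine (entry G i j A).

Coercion pm_value : psd_measure >-> Funclass.

(* Charges are unspecified outside the sigma-algebra, so equality of measures
   is tested on Borel sets only. *)
Definition eq_pm (R : realType) (d : nat) (G H : psd_measure R d) : Prop :=
  forall A : set (borelV R d), measurable A -> G A = H A.

Section trace_measure.
Context {R : realType} {d : nat}.
Variable G : psd_measure R d.

(* Measures of the library are nonnegative on every set, measurable or not,
   whence the value 0 outside the Borel sets. *)
Definition trm (A : set (borelV R d)) : \bar R :=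
  if `[< measurable A >] then (\sum_(i < d) entry G i i A)%E else 0%E.

Let trmE A : measurable A -> trm A = (\sum_(i < d) entry G i i A)%E.
Proof. by move=> mA; rewrite /trm asboolT. Qed.

Let diag_ge0 i A : measurable A -> (0 <= entry G i i A)%E.
Proof.
move=> mA; have [_ /(_ (delta_mx i 0))] := entry_psd G mA.
by rewrite /dotv -colE -colE !mxE -lee_fin fineK ?fin_num_measure.
Qed.

Let trm0 : trm set0 = 0%E.
Proof. by rewrite trmE// big1// => i _; rewrite charge0. Qed.

Let trm_ge0 A : (0 <= trm A)%E.
Proof.
rewrite /trm; case: asboolP => // mA.
by apply: sume_ge0 => i _; exact: diag_ge0.
Qed.

Let trm_sigma_additive : semi_sigma_additive trm.
Proof.
move=> F mF tF mUF; rewrite trmE//.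
under eq_fun do rewrite (eq_bigr _ (fun n _ => trmE (mF n))) exchange_big/=.
apply: cvg_nnesum => i _; last exact: charge_semi_sigma_additive.
by near=> n; apply: sume_ge0 => k _; exact: diag_ge0.
Unshelve. all: by end_near. Qed.

HB.instance Definition _ := isMeasure.Build _ _ _ trm
  trm0 trm_ge0 trm_sigma_additive.

Let trm_fin : fin_num_fun trm.
Proof.
move=> A mA; rewrite trmE//; apply/sum_fin_numP => i _ _.
exact: fin_num_measure.
Qed.

HB.instance Definition _ := Measure_isFinite.Build _ _ _ trm trm_fin.

End trace_measure.

Section integration.
Context {R : realType} {d : nat}.
Variable G : psd_measure R d.
Implicit Types (u v : 'cV[R]_d -> 'cV[R]_d) (U V : 'cV[R]_d -> 'M[R]_d).

(* The density g in G = g mu, mu = Tr G. *)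
Definition density (x : 'cV[R]_d) : 'M[R]_d :=
  \matrix_(i, j) fine (Radon_Nikodym (entry G i j) (trm G) x).

Definition int_scal (phi : 'cV[R]_d -> R) : 'M[R]_d :=
  \matrix_(i, j) \int[trm G]_x (phi x * density x i j).

Definition int_vec u v : R :=
  \int[trm G]_x dotv (density x *m u x) (v x).

Definition int_mat U V : R :=
  \int[trm G]_x ddot (density x *m U x) (V x).

(* Extended-valued versions, for integrands that are nonnegative almost
   everywhere but not known to be integrable. *)
Definition eint_vec u v : \bar R :=
  (\int[trm G]_x (dotv (density x *m u x) (v x))%:E)%E.

Definition eint_mat U V : \bar R :=
  (\int[trm G]_x (ddot (density x *m U x) (V x))%:E)%E.

Definition int_tensor (Phi : 'cV[R]_d -> 'M[R]_d) : R :=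
  \int[trm G]_x ddot (Phi x) (density x).

End integration.

Section fields.
Context {R : realType} {d : nat}.

Definition strip : set (R * 'cV[R]_d) := `[0, 1] `*` setT.

Definition bounded_continuous_on_strip (V : normedModType R)
    (f : R -> 'cV[R]_d -> V) : Prop :=
  {within strip, continuous (fun p => f p.1 p.2)} /\
  exists M : R, forall t x, 0 <= t <= 1 -> `|f t x| <= M.

(* C^1_b([0,1] x R^d; V): the first partial derivatives exist for 0 < t < 1 and
   extend continuously to t = 0 and t = 1. *)
Definition C1b (V : normedModType R) (f : R -> 'cV[R]_d -> V) : Prop :=
  bounded_continuous_on_strip f /\
  exists (ft : R -> 'cV[R]_d -> V) (fx : 'I_d -> R -> 'cV[R]_d -> V),
    [/\ bounded_continuous_on_strip ft,
        forall j, bounded_continuous_on_strip (fx j),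
        forall (t : R) x, 0 < t < 1 -> is_derive t 1 (fun s => f s x) (ft t x) &
        forall j (t : R) x, 0 < t < 1 -> is_derive x (delta_mx j 0) (f t) (fx j t x)].

Definition sym_on_strip (U : R -> 'cV[R]_d -> 'M[R]_d) : Prop :=
  forall t x, 0 <= t <= 1 -> sym_mx (U t x).

Definition div_mx (Phi : 'cV[R]_d -> 'M[R]_d) (x : 'cV[R]_d) : 'cV[R]_d :=
  \col_i \sum_(j < d) 'D_(delta_mx j 0) (fun y => Phi y i j) x.

(* Meaningful for 0 < t < 1; the endpoints are negligible in time integrals. *)
Definition dt_mx (Phi : R -> 'cV[R]_d -> 'M[R]_d) (t : R) (x : 'cV[R]_d) :
    'M[R]_d :=
  \matrix_(i, j) derive1 (fun s => Phi s x i j) t.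

Definition measurable_on_strip (f : R -> 'cV[R]_d -> R) : Prop :=
  measurable_fun (`[0, 1] `*` setT : set (R * borelV R d))
    (fun p => f p.1 p.2).

End fields.

Section kantorovich_bures.
Context {R : realType} {d : nat}.
Implicit Types (G : R -> psd_measure R d) (U : R -> 'cV[R]_d -> 'M[R]_d).
Implicit Types (u : R -> 'cV[R]_d -> 'cV[R]_d).

(* C_w([0,1]; P^+); a curve is a function on R of which only the restriction
   to [0,1] matters. *)
Definition narrow_continuous G : Prop :=
  forall phi : 'cV[R]_d -> R, continuous phi ->
    (exists M : R, forall x, `|phi x| <= M) ->
    {within `[0, 1], continuous (fun t => int_scal (G t) phi)}.

(* The squared norm of (U, u) in L^2(0,1; L^2(dG_t)). *)
Definition L2norm2 G U u : \bar R :=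
  (\int[lebesgue_measure]_(t in `[0%R, 1%R])
    (eint_vec (G t) (u t) (u t) + eint_mat (G t) (U t) (U t)))%E.

(* (U, u) represents an element of L^2(0,1; L^2(dG_t)): a measurable field of
   finite norm lying in the closure of C^1_b([0,1] x R^d; S x R^d). *)
Definition L2field G U u : Prop :=
  [/\ sym_on_strip U,
      forall i j, measurable_on_strip (fun t x => U t x i j),
      forall i, measurable_on_strip (fun t x => u t x i 0),
      (L2norm2 G U u < +oo)%E &
      forall e : R, 0 < e -> exists V v,
        [/\ sym_on_strip V, C1b V, C1b v &
            (L2norm2 G (fun t x => U t x - V t x)%R
                       (fun t x => u t x - v t x)%R < e%:E)%E]].

Definition oriented_int (s t : R) (f : R -> R) : R :=
  if s <= t then \int[lebesgue_measure]_(r in `[s, t]) f r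
  else - \int[lebesgue_measure]_(r in `[t, s]) f r.

(* The equation d_t G = {- nabla (G u) + G U}^Sym. *)
Definition weak_equation G U u : Prop :=
  forall Phi : R -> 'cV[R]_d -> 'M[R]_d, sym_on_strip Phi -> C1b Phi ->
  forall t s : R, 0 <= t <= 1 -> 0 <= s <= 1 ->
    int_tensor (G t) (Phi t) - int_tensor (G s) (Phi s)
      - oriented_int s t (fun r => int_tensor (G r) (dt_mx Phi r))
    = oriented_int s t (fun r =>
        int_vec (G r) (u r) (div_mx (Phi r)) + int_mat (G r) (U r) (Phi r)).

Definition admissible (G0 G1 : psd_measure R d) G U u : Prop :=
  [/\ narrow_continuous G, eq_pm (G 0) G0, eq_pm (G 1) G1,
      L2field G U u & weak_equation G U u].

(* Extended-valued: +oo if there is no admissible path. *)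
Definition dKB (G0 G1 : psd_measure R d) : \bar R :=
  (ereal_inf [set e | exists G U u,
     admissible G0 G1 G U u /\ e = L2norm2 G U u] `^ (2^-1)%R)%E.

End kantorovich_bures.

(* Ts is the representation, in the frame x^* = c + Q x, of the
   frame-indifferent tensor measure represented by T in the frame x. *)
Definition change_of_frame (R : realType) (d : nat) (c : 'cV[R]_d)
    (Q : 'M[R]_d) (T Ts : psd_measure R d) : Prop :=
  forall A : set (borelV R d), measurable A ->
    Ts A = Q *m T [set x | A (c + Q *m x)] *m Q^T.

(* Main.v *)
Require Import Defs.
From mathcomp Require Import all_boot all_order all_algebra.
From mathcomp Require Import all_classical all_reals all_analysis.
From mathcomp Require Import measurable_realfun.
From mathcomp Require Import ring lra.
From HB Require Import structures.
Import numFieldNormedType.Exports.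

Set Implicit Arguments.
Unset Strict Implicit.
Unset Printing Implicit Defensive.

Import Order.TTheory GRing.Theory Num.Theory.

Local Open Scope classical_set_scope.
Local Open Scope ring_scope.

(* The pushforward of a path under the isometry [x |-> c + Q x], with tensors
   conjugated by [Q], is again an admissible path, of the same energy. The trace
   of [Q G Q^T] is the image of the trace of [G], so by uniqueness of the
   Radon-Nikodym derivative the densities satisfy [g^* (c + Q x) = Q g(x) Q^T]
   almost everywhere, and all integrals involved are carried over by a change of
   variables. Test fields are pulled back; since only first partial derivatives
   are given, this needs that continuous partial derivatives yield directional
   derivatives. The inverse isometry gives the opposite inclusion between the
   sets of energies. *)

Section matrix_calculus.
Context {R : realType}.

Lemma cvg_mx (T : Type) (F : set_system T) {FF : Filter F} m n
    (f : T -> 'M[R]_(m, n)) (l : 'M[R]_(m, n)) :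
  (forall i j, f x i j @[x --> F] --> l i j) -> f x @[x --> F] --> l.
Proof.
move=> fl; apply/cvgrPdist_le => /= e e0; near=> x.
rewrite /Num.Def.normr/= mx_normrE (bigmax_le _ (ltW e0))//= => i _.
rewrite !mxE; move: i; near: x; apply: filter_forall => /= i.
exact: ((cvgrPdist_le _ _).1 (fl i.1 i.2)).
Unshelve. all: by end_near. Qed.

Lemma mulmx2E m n p q (A : 'M[R]_(p, m)) (B : 'M[R]_(n, q))
    (M : 'M[R]_(m, n)) i j :
  (A *m M *m B) i j = \sum_k \sum_l A i k * B l j * M k l.
Proof.
rewrite mxE exchange_big/=; apply: eq_bigr => l _.
by rewrite mxE mulr_suml; apply: eq_bigr => k _; rewrite mulrAC.
Qed.

Lemma mulmx2_continuous m n p q (A : 'M[R]_(p, m)) (B : 'M[R]_(n, q)) :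
  continuous (fun M : 'M[R]_(m, n) => A *m M *m B).
Proof.
move=> M; apply: (@cvg_mx _ (nbhs M)) => i j.
under eq_fun do rewrite mulmx2E.
rewrite mulmx2E.
apply: cvg_big => [|k _]; first exact: add_continuous.
apply: cvg_big => [|l _]; first exact: add_continuous.
by apply: cvgMl_tmp; exact: coord_continuous.
Qed.

Lemma mulmx2_bounded m n p q (A : 'M[R]_(p, m)) (B : 'M[R]_(n, q)) (K : R) :
  exists K', forall M : 'M[R]_(m, n), `|M| <= K -> `|A *m M *m B| <= K'.
Proof.
exists (\sum_i \sum_j \sum_k \sum_l `|A i k * B l j| * `|K|) => M MK.
have MKE k l : `|M k l| <= `|K|.
  rewrite (le_trans _ (le_trans MK (ler_norm _)))//.
  rewrite [leRHS]/Num.Def.normr/= mx_normrE.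
  exact: (le_bigmax _ (fun ij : 'I_m * 'I_n => `|M ij.1 ij.2|) (k, l)).
rewrite [leLHS]/Num.Def.normr/= mx_normrE bigmax_le//=.
  by do 4! (apply: sumr_ge0 => ? _); rewrite mulr_ge0.
move=> [i j] _ /=; rewrite mulmx2E.
have S0 i' j' : 0 <= \sum_k \sum_l `|A i' k * B l j'| * `|K|.
  by do 2! (apply: sumr_ge0 => ? _); rewrite mulr_ge0.
rewrite (bigD1 i)//= (bigD1 j)//= -addrA.
apply: ler_wpDr.
  by apply: addr_ge0; apply: sumr_ge0 => // i' _; exact: sumr_ge0.
apply: le_trans (ler_norm_sum _ _ _) _; apply: ler_sum => k _.
apply: le_trans (ler_norm_sum _ _ _) _; apply: ler_sum => l _.
by rewrite normrM ler_wpM2l.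
Qed.

Lemma is_derive_cvg (V W : normedModType R) (f : V -> W) x v l :
  is_derive x v f l <-> h^-1 *: (f (h *: v + x) - f x) @[h --> 0^'] --> l.
Proof.
split=> [[fxv <-]|fl]; first exact: fxv.
by split; [apply/cvg_ex; exists l|apply/cvg_lim].
Qed.

Lemma is_derive_mulmx2 (V : normedModType R) m n p q (A : 'M[R]_(p, m))
    (B : 'M[R]_(n, q)) (f : V -> 'M[R]_(m, n)) x v l :
  is_derive x v f l -> is_derive x v (fun y => A *m f y *m B) (A *m l *m B).
Proof.
move=> /is_derive_cvg fl; apply/is_derive_cvg.
rewrite (_ : (fun h => _) = (fun h : R =>
    A *m (h^-1 *: (f (h *: v + x) - f x)) *m B)); last first.
  by apply/funext => h; rewrite -scalemxAr -scalemxAl mulmxBr mulmxBl.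
exact: (cvg_comp _ _ fl (@mulmx2_continuous _ _ _ _ A B l)).
Qed.

Lemma is_derive_coord (V : normedModType R) m n (f : V -> 'M[R]_(m, n)) x v l
    i j :
  is_derive x v f l -> is_derive x v (fun y => f y i j) (l i j).
Proof.
move=> /is_derive_cvg fl; apply/is_derive_cvg.
rewrite (_ : (fun h => _) = (fun h : R =>
    (h^-1 *: (f (h *: v + x) - f x)) i j)); last first.
  by apply/funext => h; rewrite !mxE.
exact: (cvg_comp _ _ fl (@coord_continuous _ _ _ i j l)).
Qed.

Lemma is_derive_mx (V : normedModType R) m n (f : V -> 'M[R]_(m, n)) x v
    (l : 'M[R]_(m, n)) :
  (forall i j, is_derive x v (fun y => f y i j) (l i j)) -> is_derive x v f l.
Proof.
move=> fl; apply/is_derive_cvg; apply: cvg_mx => i j.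
have /is_derive_cvg := fl i j.
by under [in X in _ -> X]eq_fun do rewrite !mxE.
Qed.

Lemma partial_increment (V : normedModType R) (g g' : V -> R) (e : V) :
  (forall x, is_derive x e g (g' x)) ->
  forall y s, exists2 c, `|c| <= `|s| &
    g (s *: e + y) - g y = s * g' (c *: e + y).
Proof.
move=> gg' y s.
pose F (t : R) := g (t *: e + y).
have dF (t : R) : is_derive t 1 F (g' (t *: e + y)).
  apply/is_derive_cvg; have /is_derive_cvg := gg' (t *: e + y).
  rewrite [in X in _ -> X](_ : (fun h => _) = (fun h : R =>
    h^-1 *: (g (h *: e + (t *: e + y)) - g (t *: e + y))))//.
  apply/funext => h.
  by rewrite /F addrA -scalerDl [h *: 1]mulr1.
have cF : continuous F.
  by move=> t; apply/differentiable_continuous/derivable1_diffP; case: (dF t).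
have F0 : F 0 = g y by rewrite /F scale0r add0r.
rewrite -F0 -/(F s); have [s0|s0] := leP 0 s.
- have [c] := @MVT_segment R F _ 0 s s0 (fun t _ => dF t)
    (continuous_subspaceT cF).
  rewrite in_itv/= => /andP[c0 cs] ->; exists c; last by rewrite subr0 mulrC.
  by rewrite !ger0_norm.
- have [c] := @MVT_segment R F _ s 0 (ltW s0) (fun t _ => dF t)
    (continuous_subspaceT cF).
  rewrite in_itv/= => /andP[c0 cs] E; exists c.
    by rewrite (ltr0_norm s0) ler0_norm// lerN2.
  by rewrite -opprB E sub0r mulrN opprK mulrC.
Qed.

Lemma is_derive_add_partial (V : normedModType R) (g g' : V -> R) (e x w : V)
    (a l : R) :
  (forall x, is_derive x e g (g' x)) -> {for x, continuous g'} ->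
  is_derive x w g l -> is_derive x (w + a *: e) g (l + a * g' x).
Proof.
move=> gg' cg' /is_derive_cvg gw; apply/is_derive_cvg.
have /choice[c cP] (h : R) : exists c, `|c| <= `|h * a| /\
    g ((h * a) *: e + (h *: w + x)) - g (h *: w + x) =
    (h * a) * g' (c *: e + (h *: w + x)).
  by have [c] := partial_increment gg' (h *: w + x) (h * a); exists c.
have h0 : (h : R) @[h --> 0^'] --> 0 by exact: cvg_within.
have c0 : c h @[h --> 0^'] --> 0.
  apply/norm_cvg0P; apply: (@squeeze_cvgr _ _ _ _ (cst 0) (fun h => `|h * a|)).
  - by near=> h; rewrite normr_ge0; case: (cP h).
  - exact: cvg_cst.
  - apply/norm_cvg0P; rewrite -[X in _ --> X](mul0r a).
    exact: cvgMr_tmp.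
have cz : c h *: e + (h *: w + x) @[h --> 0^'] --> x.
  rewrite -[X in _ --> X]add0r -[X in X + _](scale0r e).
  rewrite -[X in _ + X]add0r -[X in _ + (X + _)](scale0r w).
  apply: cvgD; first exact: cvgZr_tmp.
  by apply: cvgD; [exact: cvgZr_tmp|exact: cvg_cst].
have H : h^-1 *: (g (h *: w + x) - g x) + a * g' (c h *: e + (h *: w + x))
    @[h --> 0^'] --> l + a * g' x.
  by apply: cvgD => //; apply: cvgMl_tmp; exact: (cvg_comp _ _ cz cg').
apply: cvg_trans H; apply: near_eq_cvg; near=> h.
have hn0 : h != 0 by near: h; exact: nbhs_dnbhs_neq.
have [_ E] := cP h.
have -> : h *: (w + a *: e) + x = (h * a) *: e + (h *: w + x).
  by rewrite scalerDr scalerA addrCA addrA.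
rewrite -[X in _ = _ *: X](subrKA (g (h *: w + x))) E [RHS]scalerDr addrC.
congr (_ + _).
rewrite /GRing.scale/= -mulrA mulKf//.
Unshelve. all: by end_near. Qed.

Lemma is_derive_total d m n (f : 'cV[R]_d -> 'M[R]_(m, n))
    (f' : 'I_d -> 'cV[R]_d -> 'M[R]_(m, n)) :
  (forall j x, is_derive x (delta_mx j 0) f (f' j x)) ->
  (forall j, continuous (f' j)) ->
  forall x v, is_derive x v f (\sum_j v j 0 *: f' j x).
Proof.
move=> ff' cf' x v; apply: is_derive_mx => i k.
have -> : (\sum_j v j 0 *: f' j x) i k = \sum_j v j 0 * f' j x i k.
  by rewrite summxE; apply: eq_bigr => j _; rewrite mxE.
have {1}-> : v = \sum_j v j 0 *: delta_mx j 0.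
  rewrite [LHS]matrix_sum_delta; apply: eq_bigr => j _.
  by rewrite big_ord1.
elim: (index_enum _) => [|j s IH].
  rewrite !big_nil; exact: is_derive0.
rewrite !big_cons addrC [X in is_derive _ _ _ X]addrC.
apply: (@is_derive_add_partial _ _ (fun y => f' j y i k)) => [|].
- by move=> y; exact: (is_derive_coord i k (ff' j y)).
- exact: (cvg_comp _ _ (cf' j x) (@coord_continuous _ _ _ i k (f' j x))).
Qed.

End matrix_calculus.

Section frame_map.
Context {R : realType} {d : nat}.
Implicit Types (c : 'cV[R]_d) (Q : 'M[R]_d).

Definition frame_map c Q (x : 'cV[R]_d) : 'cV[R]_d := c + Q *m x.

Lemma frame_map_continuous c Q : continuous (frame_map c Q).
Proof.
move=> x; apply: (@cvgD _ _ _ (nbhs x) _ (cst c) (mulmx Q)).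
  exact: cvg_cst.
rewrite (_ : mulmx Q = fun y => Q *m y *m 1%:M).
  exact: mulmx2_continuous.
by apply/funext => y; rewrite mulmx1.
Qed.

Lemma frame_mapK c Q : Q^T *m Q = 1%:M ->
  cancel (frame_map c Q) (frame_map (- (Q^T *m c)) Q^T).
Proof.
by move=> QQ x; rewrite /frame_map mulmxDr mulmxA QQ mul1mx addKr.
Qed.

Lemma frame_mapVK c Q : Q *m Q^T = 1%:M ->
  cancel (frame_map (- (Q^T *m c)) Q^T) (frame_map c Q).
Proof.
move=> QQ x; rewrite /frame_map mulmxDr mulmxN !mulmxA QQ !mul1mx.
exact: addNKr.
Qed.

Lemma bounded_continuous_on_strip_frame m n p q c Q (A : 'M[R]_(p, m))
    (B : 'M[R]_(n, q)) (f : R -> 'cV[R]_d -> 'M[R]_(m, n)) :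
  bounded_continuous_on_strip f ->
  bounded_continuous_on_strip (fun t x => A *m f t (frame_map c Q x) *m B).
Proof.
move=> [cf [M fM]]; split; last first.
  have [M' MM'] := mulmx2_bounded A B M.
  by exists M' => t x t01; exact/MM'/fM.
move/subspace_continuousP : cf => cf.
apply/subspace_continuousP => -[t x] tx /=.
have stx : strip (t, frame_map c Q x) by case: tx.
have fr : (fun p : R * 'cV[R]_d => (p.1, frame_map c Q p.2)) @
    within strip (nbhs (t, x)) --> within strip (nbhs (t, frame_map c Q x)).
  have K : (fun p : R * 'cV[R]_d => (p.1, frame_map c Q p.2)) @
      nbhs (t, x) --> nbhs (t, frame_map c Q x).
    apply: (@cvg_pair _ _ _ (nbhs (t, x)) (nbhs t) (nbhs (frame_map c Q x)) _
      _ _ fst (fun p => frame_map c Q p.2)); first exact: cvg_fst.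
    apply: (@cvg_comp _ _ _ snd (frame_map c Q) _ (nbhs x)).
      exact: cvg_snd.
    exact: frame_map_continuous.
  move=> W /K KW'.
  have KW : nbhs (t, x) [set p | strip (p.1, frame_map c Q p.2) ->
    W (p.1, frame_map c Q p.2)] by exact: KW'.
  change (nbhs (t, x) [set p |
    strip p -> W (p.1, frame_map c Q p.2)]).
  apply: (filterS _ KW) => -[r y] /= rW [r01 _].
  exact: rW.
exact: (cvg_comp _ _ (cvg_comp _ _ fr (cf _ stx))
  (@mulmx2_continuous _ _ _ _ _ A B _)).
Qed.

Lemma bounded_continuous_on_strip_sum m n (I : finType) (a : I -> R)
    (f : I -> R -> 'cV[R]_d -> 'M[R]_(m, n)) :
  (forall i, bounded_continuous_on_strip (f i)) ->
  bounded_continuous_on_strip (fun t x => \sum_i a i *: f i t x).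
Proof.
move=> fP; split.
  apply/subspace_continuousP => -[t x] tx /=.
  apply: cvg_big => [|i _]; first exact: add_continuous.
  have [/subspace_continuousP/(_ _ tx) fi _] := fP i.
  exact: cvgZl_tmp.
have /choice[M fM] i := (fP i).2.
exists (\sum_i `|a i| * M i) => t x t01.
rewrite (le_trans (ler_norm_sum _ _ _))// ler_sum// => i _.
by rewrite normrZ ler_wpM2l// fM.
Qed.

Lemma bounded_continuous_on_strip_section m n
    (f : R -> 'cV[R]_d -> 'M[R]_(m, n)) t :
  bounded_continuous_on_strip f -> 0 <= t <= 1 -> continuous (f t).
Proof.
move=> [/subspace_continuousP cf _] t01 x.
have tx : strip (t, x) by split; rewrite //= in_itv.
move=> W /(cf _ tx) /= [[B C] /= [tB xC] BC].
apply: (filterS _ xC) => y Cy; apply: (BC (t, y)); last first.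
  by split; rewrite //= in_itv.
by split => //; exact: nbhs_singleton.
Qed.

Lemma is_derive_frame_map (V : normedModType R) c Q (f : 'cV[R]_d -> V) x v l :
  is_derive (frame_map c Q x) (Q *m v) f l ->
  is_derive x v (fun y => f (frame_map c Q y)) l.
Proof.
move=> /is_derive_cvg fl; apply/is_derive_cvg.
rewrite (_ : (fun h => _) = (fun h : R => h^-1 *:
  (f (h *: (Q *m v) + frame_map c Q x) - f (frame_map c Q x))))//.
by apply/funext => h; rewrite /frame_map mulmxDr -scalemxAr addrCA.
Qed.

Lemma C1b_is_derive m n (f : R -> 'cV[R]_d -> 'M[R]_(m, n)) t x v :
  C1b f -> 0 < t < 1 ->
  is_derive x v (f t) (\sum_j v j 0 *: 'D_(delta_mx j 0) (f t) x).
Proof.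
move=> [_ [_ [fx [_ fxP _ ffx]]]] t01.
have t01' : 0 <= t <= 1 by case/andP : t01 => t0 t1; rewrite !ltW.
have -> : \sum_j v j 0 *: 'D_(delta_mx j 0) (f t) x =
          \sum_j v j 0 *: fx j t x.
  by apply: eq_bigr => j _; have [_ ->] := ffx j t x t01.
apply: (@is_derive_total _ _ _ _ (f t) (fun j => fx j t)) => j.
  by move=> y; exact: ffx.
exact: bounded_continuous_on_strip_section.
Qed.

Lemma C1b_frame m n p q c Q (A : 'M[R]_(p, m)) (B : 'M[R]_(n, q))
    (f : R -> 'cV[R]_d -> 'M[R]_(m, n)) :
  C1b f -> C1b (fun t x => A *m f t (frame_map c Q x) *m B).
Proof.
move=> f1; have [fP [ft [fx [ftP fxP fft ffx]]]] := f1.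
split; first exact: bounded_continuous_on_strip_frame.
exists (fun t x => A *m ft t (frame_map c Q x) *m B),
  (fun j t x => A *m (\sum_l Q l j *: fx l t (frame_map c Q x)) *m B); split.
- exact: bounded_continuous_on_strip_frame.
- move=> j; pose g t x := \sum_l Q l j *: fx l t x.
  apply: (@bounded_continuous_on_strip_frame _ _ _ _ c Q A B g).
  exact: bounded_continuous_on_strip_sum.
- by move=> t x t01; apply: is_derive_mulmx2; exact: fft.
- move=> j t x t01; apply: is_derive_mulmx2; apply: is_derive_frame_map.
  have := C1b_is_derive (frame_map c Q x) (Q *m delta_mx j 0) f1 t01.
  congr is_derive; apply: eq_bigr => l _; rewrite -colE mxE.
  by have [_ ->] := ffx l t (frame_map c Q x) t01.
Qed.

Lemma C1b_frame_vec n c Q (A : 'M[R]_n) (f : R -> 'cV[R]_d -> 'cV[R]_n) :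
  C1b f -> C1b (fun t x => A *m f t (frame_map c Q x)).
Proof.
move=> f1; have := C1b_frame c Q A (1%:M : 'M[R]_1) f1; congr C1b.
by apply/funext => t; apply/funext => x; rewrite mulmx1.
Qed.

Lemma div_mx_frame c Q (Phi : R -> 'cV[R]_d -> 'M[R]_d) t x :
  Q *m Q^T = 1%:M -> C1b Phi -> 0 < t < 1 ->
  div_mx (fun y => Q^T *m Phi t (frame_map c Q y) *m Q) x =
  Q^T *m div_mx (Phi t) (frame_map c Q x).
Proof.
move=> QQ P1 t01; set y := frame_map c Q x.
pose D l := 'D_(delta_mx l 0) (Phi t) y.
have DE i l : 'D_(delta_mx l 0) (fun z => Phi t z i l) y = D l i l.
  have := C1b_is_derive y (delta_mx l 0) P1 t01.
  case=> dP _.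
  have [_ ->] := is_derive_coord i l (derivableP dP).
  by [].
have DE' i j : 'D_(delta_mx j 0)
    (fun z => (Q^T *m Phi t (frame_map c Q z) *m Q) i j) x =
    (Q^T *m (\sum_l Q l j *: D l) *m Q) i j.
  have H : is_derive x (delta_mx j 0) (fun z =>
      Q^T *m Phi t (frame_map c Q z) *m Q) (Q^T *m (\sum_l Q l j *: D l) *m Q).
    apply: is_derive_mulmx2; apply: is_derive_frame_map.
    have := C1b_is_derive y (Q *m delta_mx j 0) P1 t01.
    by congr is_derive; apply: eq_bigr => l _; rewrite -colE mxE.
  by have [_ ->] := is_derive_coord i j H.
apply/colP => i; rewrite !mxE.
rewrite (eq_bigr (fun j =>
    \sum_l (Q^T *m (Q l j *: D l) *m Q) i j)); last first.
  by move=> j _; rewrite DE' mulmx_sumr mulmx_suml summxE.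
rewrite exchange_big/=.
transitivity (\sum_l (Q^T *m D l) i l).
  apply: eq_bigr => l _.
  transitivity ((Q^T *m D l *m (Q *m Q^T)) i l); last by rewrite QQ mulmx1.
  rewrite mulmxA [RHS]mxE; apply: eq_bigr => j _.
  by rewrite -scalemxAr -scalemxAl !mxE mulrC.
rewrite (eq_bigr (fun l => \sum_k Q^T i k * D l k l)); last first.
  by move=> l _; rewrite mxE.
rewrite exchange_big/=; apply: eq_bigr => k _.
rewrite !mxE big_distrr/=; apply: eq_bigr => l _.
by rewrite DE.
Qed.

Lemma dt_mx_frame c Q (Phi : R -> 'cV[R]_d -> 'M[R]_d) t x :
  C1b Phi -> 0 < t < 1 ->
  dt_mx (fun s y => Q^T *m Phi s (frame_map c Q y) *m Q) t x =
  Q^T *m dt_mx Phi t (frame_map c Q x) *m Q.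
Proof.
move=> [_ [ft [_ [_ _ fft _]]]] t01; set y := frame_map c Q x.
have Pt := fft t y t01.
have -> : dt_mx Phi t y = ft t y.
  apply/matrixP => i j; rewrite mxE derive1E.
  by have [_ ->] := is_derive_coord i j Pt.
apply/matrixP => i j; rewrite [LHS]mxE derive1E.
by have [_ ->] := is_derive_coord i j (is_derive_mulmx2 Q^T Q Pt).
Qed.

End frame_map.

Section measurable_isomorphism.
Local Open Scope ereal_scope.
Context d1 d2 (X : measurableType d1) (Y : measurableType d2) (R : realType).
Variables (mu : {measure set X -> \bar R}) (nu : {measure set Y -> \bar R}).
Variables (phi : X -> Y) (psi : Y -> X).
Hypotheses (mphi : measurable_fun setT phi) (mpsi : measurable_fun setT psi).
Hypotheses (phiK : cancel phi psi).
Hypothesis nuE : forall A, measurable A -> nu A = mu (phi @^-1` A).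

Import HBNNSimple.

Let comp_nnsfun (h : {nnsfun X >-> R}) :
  {k : {nnsfun Y >-> R} | k = h \o psi :> (Y -> R)}.
Proof.
have m : measurable_fun setT (h \o psi) by exact: measurableT_comp.
have f : finite_set (range (h \o psi)).
  apply: sub_finite_set (fimfunP h) => _ [y _ <-].
  by exists (psi y).
have n x : (0 <= (h \o psi) x)%R by exact: fun_ge0.
pose k : {nnsfun Y >-> R} := HB.pack (h \o psi)
  (isMeasurableFun.Build _ _ _ _ _ m) (FiniteImage.Build _ _ _ f)
  (isNonNegFun.Build _ _ _ n).
by exists k.
Qed.

Lemma ge0_integral_le_isomorphism (N : set X) (f : X -> \bar R)
    (g : Y -> \bar R) :
  measurable N -> mu N = 0 -> (forall x, 0 <= f x) -> (forall y, 0 <= g y) ->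
  (forall y, ~ N (psi y) -> f (psi y) <= g y) ->
  \int[mu]_x f x <= \int[nu]_y g y.
Proof.
move=> mN N0 f0 g0 fg; rewrite !ge0_integralTE//.
apply: ge_ereal_sup => _ [h /= hf <-].
have mCN : measurable (~` N) by exact: measurableC.
have [k kE] := comp_nnsfun (proj_nnsfun h mCN).
apply: ereal_sup_ubound; exists k => /=.
  move=> y; rewrite kE /= mindicE in_setC.
  have [Ny|Ny] := boolP (psi y \in N); first by rewrite mulr0 g0.
  rewrite mulr1 (le_trans (hf _))// fg//.
  by move/negP: Ny; rewrite inE.
rewrite !sintegralET; apply: eq_fsbigr => r _.
have [->|r0] := eqVneq r 0%R; first by rewrite !mul0e.
have mh : measurable (h @^-1` [set r]) by [].
have -> : k @^-1` [set r] = psi @^-1` (h @^-1` [set r] `\` N).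
  apply/seteqP; split => y /=; rewrite kE /= mindicE in_setC.
    have [Ny|/negP Ny] := boolP (psi y \in N).
      by rewrite mulr0 => /esym/eqP; rewrite (negbTE r0).
    by rewrite mulr1 => ->; split => //; move: Ny; rewrite inE.
  by move=> [<- Ny]; rewrite memNset//= mulr1.
have mhN : measurable (h @^-1` [set r] `\` N) by exact: measurableD.
rewrite nuE; last by rewrite -[X in measurable X]setTI; exact: mpsi.
rewrite -comp_preimage (_ : psi \o phi = id); last by apply/funext => x /=.
congr (_ * _); rewrite preimage_id (measureDI mu mh mN).
rewrite [X in _ + X](_ : _ = 0) ?adde0//.
by apply: (subset_measure0 _ mN _ N0) => //; exact: measurableI.
Qed.

End measurable_isomorphism.

(* No measurability of the integrands is needed: the integral is a supremum
   over simple functions, which are transported by the isomorphism. *)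
Lemma integral_isomorphism d1 d2 (X : measurableType d1)
    (Y : measurableType d2) (R : realType) (mu : {measure set X -> \bar R})
    (nu : {measure set Y -> \bar R}) (phi : X -> Y) (psi : Y -> X)
    (N : set X) (f : X -> \bar R) (g : Y -> \bar R) :
  measurable_fun setT phi -> measurable_fun setT psi ->
  cancel phi psi -> cancel psi phi ->
  (forall A, measurable A -> nu A = mu (phi @^-1` A)) ->
  measurable N -> mu N = 0%E -> (forall x, ~ N x -> f x = g (phi x)) ->
  (\int[mu]_x f x = \int[nu]_y g y)%E.
Proof.
move=> mphi mpsi phiK psiK nuE mN N0 fg.
have mpsiN : measurable (psi @^-1` N).
  by rewrite -[X in measurable X]setTI; exact: mpsi.
have phipsi A : phi @^-1` (psi @^-1` A) = A.
  by apply/seteqP; split => x /=; rewrite phiK.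
have muE A : measurable A -> mu A = nu (psi @^-1` A).
  by move=> mA; rewrite nuE ?phipsi// -[X in measurable X]setTI; exact: mpsi.
have nuN0 : nu (psi @^-1` N) = 0%E by rewrite -muE.
have H (f' : X -> \bar R) (g' : Y -> \bar R) :
    (forall x, 0 <= f' x)%E -> (forall y, 0 <= g' y)%E ->
    (forall x, ~ N x -> f' x = g' (phi x)) ->
    (\int[mu]_x f' x = \int[nu]_y g' y)%E.
  move=> f0 g0 fg'; apply/eqP; rewrite eq_le; apply/andP; split.
    apply: (ge0_integral_le_isomorphism mpsi phiK nuE mN N0) => // y Ny.
    by rewrite fg'// psiK.
  apply: (ge0_integral_le_isomorphism mphi psiK muE mpsiN nuN0) => // x.
  by rewrite /= phiK => Nx; rewrite fg'.
rewrite [LHS]integralE [RHS]integralE.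
by congr (_ - _)%E; apply: H => // x Nx; rewrite /= !(funeposE, funenegE) fg.
Qed.

Lemma eq_integral_off_null d (X : measurableType d) (R : realType)
    (mu : {measure set X -> \bar R}) (N D : set X) (f g : X -> \bar R) :
  measurable N -> mu N = 0%E -> (forall x, D x -> ~ N x -> f x = g x) ->
  (\int[mu]_(x in D) f x = \int[mu]_(x in D) g x)%E.
Proof.
move=> mN N0 fg; rewrite integral_mkcond [RHS]integral_mkcond.
apply: (@integral_isomorphism _ _ _ _ _ _ _ id id N) => // x Nx.
by rewrite /patch/=; case: ifPn => // /[!inE] Dx; exact: fg.
Qed.

Section charges.
Context d (T : measurableType d) (R : realType).
Local Open Scope ereal_scope.

Lemma charge_linear_combination (I : Type) (s : seq I) (a : I -> R)
    (nu : I -> {charge set T -> \bar R}) :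
  exists mu : {charge set T -> \bar R},
    forall A, mu A = \sum_(i <- s) (a i)%:E * nu i A.
Proof.
elim: s => [|i s [mu muE]].
  by exists (@czero _ T R) => A; rewrite big_nil.
exists (cadd (cscale (a i) (nu i)) mu) => A.
by rewrite big_cons -muE.
Qed.

Lemma charge_preimage d' (T' : measurableType d') (f : T -> T')
    (nu : {charge set T -> \bar R}) : measurable_fun setT f ->
  exists mu : {charge set T' -> \bar R}, forall A, mu A = nu (f @^-1` A).
Proof.
move=> mf.
unshelve eexists (pushforward nu f : {charge set T' -> \bar R}); last by [].
exact: mf.
Qed.

End charges.

Section change_of_frame.
Context {R : realType} {d : nat}.
Implicit Types (c : 'cV[R]_d) (Q : 'M[R]_d) (G Gs : psd_measure R d).

Lemma frame_map_measurable c Q :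
  measurable_fun setT (frame_map c Q : borelV R d -> borelV R d).
Proof.
apply: (@measurability _ _ (borelV R d) (borelV R d) setT (frame_map c Q)
  (@open 'cV[R]_d)) => //.
move=> _ [A oA <-]; rewrite setTI; apply: sub_sigma_algebra.
move/continuousP : (@frame_map_continuous R d c Q); exact.
Qed.

Lemma measurable_frame_preimage c Q (A : set (borelV R d)) :
  measurable A -> measurable (frame_map c Q @^-1` A : set (borelV R d)).
Proof.
by move=> mA; rewrite -[X in measurable X]setTI; exact: frame_map_measurable.
Qed.

Lemma orthogonal_mx_tr Q : orthogonal_mx Q -> Q^T *m Q = 1%:M.
Proof. exact: mulmx1C. Qed.

Lemma orthogonal_trmx Q : orthogonal_mx Q -> orthogonal_mx Q^T.
Proof. by move=> /orthogonal_mx_tr; rewrite /orthogonal_mx trmxK. Qed.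

Lemma entryE G i j (A : set (borelV R d)) :
  measurable A -> entry G i j A = (G A i j)%:E.
Proof. by move=> mA; rewrite mxE fineK// fin_num_measure. Qed.

Lemma trm_tr G (A : set (borelV R d)) :
  measurable A -> trm G A = (\tr (G A))%:E.
Proof.
move=> mA; rewrite /trm asboolT// /mxtrace -sumEFin.
by apply: eq_bigr => i _; rewrite entryE.
Qed.

Lemma psd_mx_conj Q (M : 'M[R]_d) : psd_mx M -> psd_mx (Q *m M *m Q^T).
Proof.
move=> [sM pM]; split; first by rewrite /sym_mx !trmx_mul trmxK sM mulmxA.
move=> v; rewrite (_ : dotv _ _ = dotv (M *m (Q^T *m v)) (Q^T *m v))//.
by rewrite /dotv !trmx_mul trmxK !mulmxA.
Qed.

Lemma psd_mx_tr0 (M : 'M[R]_d) : psd_mx M -> \tr M = 0 -> M = 0.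
Proof.
move=> [sM pM] M0.
have B i j : dotv (M *m delta_mx i 0) (delta_mx j 0) = M i j.
  by rewrite /dotv -colE -colE !mxE -[in RHS]sM mxE.
have E i j (s : R) : dotv (M *m (delta_mx i 0 + s *: delta_mx j 0))
    (delta_mx i 0 + s *: delta_mx j 0) =
    M i i + s * M j i + s * (M i j + s * M j j).
  rewrite -!B /dotv !mulmxDr -!scalemxAr !linearD/= !linearZ/= !mulmxDl.
  by rewrite -!scalemxAl !mxE; ring.
have Mii_ge0 i : 0 <= M i i by rewrite -B.
have Mii i : M i i = 0.
  apply/eqP; move: M0 => /eqP; rewrite psumr_eq0// => /allP/(_ i).
  by rewrite mem_index_enum; exact.
apply/matrixP => i j; rewrite mxE.
have := pM (delta_mx i 0 + 1 *: delta_mx j 0).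
have := pM (delta_mx i 0 + (-1) *: delta_mx j 0).
have Mji : M j i = M i j by rewrite -[in LHS]sM mxE.
by rewrite !E !Mii Mji; lra.
Qed.

Lemma entry_dominates G i j : entry G i j `<< trm G.
Proof.
apply/null_content_dominatesP => A mA.
move=> /(etrans (esym (trm_tr G mA)))[trA].
by rewrite entryE// (psd_mx_tr0 _ trA) ?mxE//; exact: entry_psd.
Qed.

Lemma change_of_frame_exists c Q G : exists Gs, change_of_frame c Q G Gs.
Proof.
have /choice[nu nuE] (ij : 'I_d * 'I_d) :
    exists nu : {charge set (borelV R d) -> \bar R},
    forall A : set (borelV R d), measurable A ->
    nu A = ((Q *m G (frame_map c Q @^-1` A) *m Q^T) ij.1 ij.2)%:E.
  have [mu muE] := charge_linear_combination
    (index_enum ('I_d * 'I_d)%type) (fun kl => Q ij.1 kl.1 * Q^T kl.2 ij.2)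
    (fun kl => entry G kl.1 kl.2).
  have [nu nuE] := charge_preimage mu (@frame_map_measurable c Q).
  exists nu => A mA; rewrite nuE muE mulmx2E pair_big/= -sumEFin.
  apply: eq_bigr => -[k l] _; rewrite EFinM entryE//.
  exact: measurable_frame_preimage.
have nuM (A : set (borelV R d)) : measurable A ->
    \matrix_(i, j) fine (nu (i, j) A) =
    Q *m G (frame_map c Q @^-1` A) *m Q^T.
  by move=> mA; apply/matrixP => i j; rewrite mxE nuE.
have nu_psd (A : set (borelV R d)) : measurable A ->
    psd_mx (\matrix_(i, j) fine (nu (i, j) A)).
  move=> mA; rewrite nuM//; apply: psd_mx_conj.
  by apply: entry_psd; exact: measurable_frame_preimage.
by exists (@PsdMeasure R d (fun i j => nu (i, j)) nu_psd) => A mA; exact: nuM.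
Qed.

Lemma change_of_frame_sym c Q G Gs : orthogonal_mx Q ->
  change_of_frame c Q G Gs -> change_of_frame (- (Q^T *m c)) Q^T Gs G.
Proof.
move=> QQ GGs A mA.
have QQ' := orthogonal_mx_tr QQ.
rewrite GGs; last exact: measurable_frame_preimage.
rewrite (_ : [set x | _] = A); last first.
  apply/seteqP; split => x /=; rewrite -/(frame_map _ _ _) -/(frame_map _ _ _);
  by rewrite frame_mapK.
by rewrite trmxK !mulmxA QQ' mul1mx -mulmxA QQ' mulmx1.
Qed.

Section transport.
Variables (c : 'cV[R]_d) (Q : 'M[R]_d) (G Gs : psd_measure R d).
Hypotheses (Qo : orthogonal_mx Q) (GGs : change_of_frame c Q G Gs).

Let phi := frame_map c Q.
Let psi := frame_map (- (Q^T *m c)) Q^T.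

Let phiK : cancel phi psi.
Proof. by apply: frame_mapK; exact: orthogonal_mx_tr. Qed.

Lemma trm_change_of_frame (A : set (borelV R d)) :
  measurable A -> trm Gs A = trm G (phi @^-1` A).
Proof.
move=> mA; rewrite !trm_tr ?GGs//; last exact: measurable_frame_preimage.
by rewrite mxtrace_mulC mulmxA (orthogonal_mx_tr Qo) mul1mx.
Qed.

Lemma integral_trm_frame (N : set (borelV R d)) (f g : 'cV[R]_d -> \bar R) :
  measurable N -> trm G N = 0%E -> (forall x, ~ N x -> f x = g (phi x)) ->
  (\int[trm G]_x f x = \int[trm Gs]_y g y)%E.
Proof.
move=> mN N0 fg.
apply: (@integral_isomorphism _ _ _ _ _ (trm G) (trm Gs) phi psi N) => //.
- exact: frame_map_measurable.
- exact: frame_map_measurable.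
- exact: frame_mapVK.
- exact: trm_change_of_frame.
Qed.

Lemma density_frame_entry i j :
  {ae trm G, forall x, density Gs (phi x) i j = (Q *m density G x *m Q^T) i j}.
Proof.
pose rn k l := Radon_Nikodym (entry G k l) (trm G).
have rnE k l x : rn k l x = (density G x k l)%:E.
  by rewrite mxE fineK// Radon_Nikodym_fin_num//; exact: entry_dominates.
have irn k l : (trm G).-integrable setT (rn k l).
  by apply: Radon_Nikodym_integrable; exact: entry_dominates.
pose f x := (\sum_k \sum_l (Q i k * Q^T l j)%:E * rn k l x)%E.
pose g := Radon_Nikodym (entry Gs i j) (trm Gs).
have intf E : measurable E -> (trm G).-integrable E f.
  move=> mE; apply: integrable_sum => // k _; apply: integrable_sum => // l _.
  by apply: integrableZl => //; exact: integrableS (irn k l).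
have : ae_eq (trm G) setT f (g \o phi).
  apply: integral_ae_eq => //.
  - exact: intf.
  - apply: measurableT_comp; last exact: frame_map_measurable.
    apply: measurable_int; apply: Radon_Nikodym_integrable.
    exact: entry_dominates.
  - move=> E _ mE.
    have mpsiE := @measurable_frame_preimage (- (Q^T *m c)) Q^T _ mE.
    have -> : (\int[trm G]_(x in E) (g \o phi) x =
               \int[trm Gs]_(y in psi @^-1` E) g y)%E.
      rewrite integral_mkcond [RHS]integral_mkcond.
      apply: (@integral_trm_frame set0) => // x _.
      rewrite /patch/=; have -> // : (phi x \in psi @^-1` E) = (x \in E).
      by apply/idP/idP => /[!inE]/=; rewrite phiK.
    have -> : (\int[trm Gs]_(y in psi @^-1` E) g y =
               entry Gs i j (psi @^-1` E))%E.
      by rewrite (@Radon_Nikodym_integral _ _ _ _ (trm Gs))//;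
        exact: entry_dominates.
    rewrite entryE// (GGs mpsiE) mulmx2E.
    have -> : [set x | (psi @^-1` E) (c + Q *m x)] = E.
      by apply/seteqP; split => x /=; rewrite -/(phi x) phiK.
    rewrite integral_sum//; last first.
      move=> k; apply: integrable_sum => // l _.
      by apply: integrableZl => //; exact: integrableS (irn k l).
    rewrite -sumEFin; apply: eq_bigr => k _.
    rewrite integral_sum//; last first.
      by move=> l; apply: integrableZl => //; exact: integrableS (irn k l).
    rewrite -sumEFin; apply: eq_bigr => l _.
    rewrite integralZl//; last exact: integrableS (irn k l).
    rewrite [RHS]EFinM; congr (_ * _)%E; rewrite -[RHS](entryE G k l mE).
    by rewrite (@Radon_Nikodym_integral _ _ _ _ (trm G))//;
      exact: entry_dominates.
apply: filterS => x /(_ I) fg.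
rewrite mulmx2E [LHS]mxE -/g -[g (phi x)]/((g \o phi) x) -fg /f.
rewrite -[RHS]/(fine (\sum_k \sum_l Q i k * Q^T l j * density G x k l)%:E).
congr fine; rewrite -sumEFin; apply: eq_bigr => k _.
by rewrite -sumEFin; apply: eq_bigr => l _; rewrite rnE EFinM.
Qed.

Lemma density_frame : exists N : set (borelV R d),
  [/\ measurable N, trm G N = 0%E &
    forall x, ~ N x -> density Gs (phi x) = Q *m density G x *m Q^T].
Proof.
have : {ae trm G, forall x, forall ij : 'I_d * 'I_d,
    density Gs (phi x) ij.1 ij.2 = (Q *m density G x *m Q^T) ij.1 ij.2}.
  apply: filter_forall => ij; exact: density_frame_entry.
move=> [N [mN N0 subN]]; exists N; split => // x Nx.
apply/matrixP => i j; apply: contrapT => E; apply/Nx/subN => /(_ (i, j)).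
exact: E.
Qed.

End transport.
End change_of_frame.

Section integrals_frame.
Context {R : realType} {d : nat}.
Variables (c : 'cV[R]_d) (Q : 'M[R]_d) (G Gs : psd_measure R d).
Hypotheses (Qo : orthogonal_mx Q) (GGs : change_of_frame c Q G Gs).

Let phi := frame_map c Q.

Lemma integral_density_frame (F : 'cV[R]_d -> 'M[R]_d -> \bar R) :
  (\int[trm Gs]_y F y (density Gs y) =
   \int[trm G]_x F (phi x) (Q *m density G x *m Q^T))%E.
Proof.
have [N [mN N0 NE]] := density_frame Qo GGs.
apply/esym; apply: (integral_trm_frame Qo GGs mN N0) => x Nx.
by rewrite -NE.
Qed.

Lemma dotv_frame (M : 'M[R]_d) (u v : 'cV[R]_d) :
  dotv (Q *m M *m Q^T *m u) v = dotv (M *m (Q^T *m u)) (Q^T *m v).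
Proof. by rewrite /dotv !trmx_mul trmxK !mulmxA. Qed.

Lemma ddot_frame (M U V : 'M[R]_d) :
  ddot (Q *m M *m Q^T *m U) V = ddot (M *m (Q^T *m U *m Q)) (Q^T *m V *m Q).
Proof.
rewrite /ddot !trmx_mul trmxK -!mulmxA mxtrace_mulC -!mulmxA.
by rewrite [Q *m (Q^T *m _)]mulmxA Qo mul1mx.
Qed.

Lemma eint_vec_frame (u v : 'cV[R]_d -> 'cV[R]_d) :
  eint_vec Gs u v =
  eint_vec G (fun x => Q^T *m u (phi x)) (fun x => Q^T *m v (phi x)).
Proof.
rewrite /eint_vec.
rewrite (integral_density_frame (fun y M => (dotv (M *m u y) (v y))%:E)).
by apply: eq_integral => x _; rewrite dotv_frame.
Qed.

Lemma eint_mat_frame (U V : 'cV[R]_d -> 'M[R]_d) :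
  eint_mat Gs U V = eint_mat G (fun x => Q^T *m U (phi x) *m Q)
                               (fun x => Q^T *m V (phi x) *m Q).
Proof.
rewrite /eint_mat.
rewrite (integral_density_frame (fun y M => (ddot (M *m U y) (V y))%:E)).
by apply: eq_integral => x _; rewrite ddot_frame.
Qed.

Lemma int_vec_frame (u v : 'cV[R]_d -> 'cV[R]_d) :
  int_vec Gs u v =
  int_vec G (fun x => Q^T *m u (phi x)) (fun x => Q^T *m v (phi x)).
Proof. by congr fine; exact: eint_vec_frame. Qed.

Lemma int_mat_frame (U V : 'cV[R]_d -> 'M[R]_d) :
  int_mat Gs U V = int_mat G (fun x => Q^T *m U (phi x) *m Q)
                             (fun x => Q^T *m V (phi x) *m Q).
Proof. by congr fine; exact: eint_mat_frame. Qed.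

Lemma int_tensor_frame (Phi : 'cV[R]_d -> 'M[R]_d) :
  int_tensor Gs Phi = int_tensor G (fun x => Q^T *m Phi (phi x) *m Q).
Proof.
congr fine; rewrite (integral_density_frame (fun y M => (ddot (Phi y) M)%:E)).
apply: eq_integral => x _; rewrite /ddot !trmx_mul trmxK !mulmxA.
by rewrite mxtrace_mulC !mulmxA.
Qed.

Lemma integrable_density (f : 'cV[R]_d -> R) i j : continuous f ->
  (exists M, forall x, `|f x| <= M) ->
  (trm G).-integrable setT (fun x => (f x * density G x i j)%:E).
Proof.
move=> cf [M fM].
have dom := @entry_dominates R d G i j.
rewrite (_ : (fun x => _) =
    ((EFin \o f) \* Radon_Nikodym (entry G i j) (trm G))%E); last first.
  apply/funext => x; rewrite mxE/= EFinM fineK//.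
  exact: Radon_Nikodym_fin_num.
apply: integrableMr => //; last exact: Radon_Nikodym_integrable.
  apply: (@measurability _ _ (borelV R d) R setT f _
    (RGenOInfty.measurableE R)).
  move=> _ [_ [x ->] <-]; rewrite setTI; apply: sub_sigma_algebra.
  by move/continuousP : cf; apply; rewrite set_itvE; exact: open_gt.
exists M; split; first exact: num_real.
by move=> x Mx y _; exact: le_trans (fM y) (ltW Mx).
Qed.

Lemma int_scal_frame (f : 'cV[R]_d -> R) : continuous f ->
  (exists M, forall x, `|f x| <= M) ->
  int_scal Gs f = Q *m int_scal G (f \o phi) *m Q^T.
Proof.
move=> cf fM.
have intf k l : (trm G).-integrable setT
    (fun x => (f (phi x) * density G x k l)%:E).
  apply: (@integrable_density (f \o phi)).
    move=> x; apply: continuous_comp; last exact: cf.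
    exact: frame_map_continuous.
  by have [M H] := fM; exists M => x; exact: H.
apply/matrixP => i j; rewrite mxE mulmx2E.
have -> : \sum_k \sum_l Q i k * Q^T l j * int_scal G (f \o phi) k l =
  fine (\sum_k \sum_l (Q i k * Q^T l j)%:E *
    \int[trm G]_x (f (phi x) * density G x k l)%:E)%E.
  rewrite -[LHS]/(fine (_)%:E); congr fine.
  rewrite -sumEFin; apply: eq_bigr => k _.
  rewrite -sumEFin; apply: eq_bigr => l _.
  rewrite [LHS]EFinM; congr (_ * _)%E; rewrite mxE /Rintegral fineK//.
  exact: integrable_fin_num.
congr fine.
rewrite (integral_density_frame (fun y M => (f y * M i j)%:E)).
transitivity (\int[trm G]_x \sum_k \sum_l (Q i k * Q^T l j)%:E *
    (f (phi x) * density G x k l)%:E)%E.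
  apply: eq_integral => x _; rewrite mulmx2E mulr_sumr -sumEFin.
  apply: eq_bigr => k _; rewrite mulr_sumr -sumEFin; apply: eq_bigr => l _.
  by rewrite -EFinM mulrCA.
have int_kl k l : (trm G).-integrable setT (fun x =>
    (Q i k * Q^T l j)%:E * (f (phi x) * density G x k l)%:E)%E.
  exact: integrableZl.
rewrite integral_sum//; last by move=> k; exact: integrable_sum.
apply: eq_bigr => k _; rewrite integral_sum//.
by apply: eq_bigr => l _; rewrite integralZl.
Qed.

End integrals_frame.

Section admissible_frame.
Context {R : realType} {d : nat}.

Lemma oriented_int_eq (f g : R -> R) (s t : R) : 0 <= s <= 1 -> 0 <= t <= 1 ->
  (forall r, 0 < r < 1 -> f r = g r) -> oriented_int s t f = oriented_int s t g.
Proof.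
move=> /andP[s0 s1] /andP[t0 t1] fg.
have H (a b : R) : 0 <= a -> b <= 1 ->
    \int[lebesgue_measure]_(r in `[a, b]) f r =
    \int[lebesgue_measure]_(r in `[a, b]) g r.
  move=> a0 b1; congr fine.
  have mN : measurable ([set 0] `|` [set 1] : set (measurableTypeR R)).
    exact: measurableU.
  apply: (eq_integral_off_null mN) => [|x].
  - apply: countable_lebesgue_measure0; apply: finite_set_countable.
    exact: finite_set2.
  - rewrite /= in_itv/= => /andP[ax xb] /not_orP[/eqP x0 /eqP x1].
    rewrite fg// !lt_neqAle x1 eq_sym x0 (le_trans a0 ax).
    exact: le_trans xb b1.
by rewrite /oriented_int; case: ifP => _; [|congr (- _)]; exact: H.
Qed.

Lemma measurable_on_strip_frame m n p q (c : 'cV[R]_d) (Q : 'M[R]_d)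
    (A : 'M[R]_(p, m)) (B : 'M[R]_(n, q)) (U : R -> 'cV[R]_d -> 'M[R]_(m, n)) :
  (forall i j, measurable_on_strip (fun t x => U t x i j)) ->
  forall i j, measurable_on_strip
    (fun t x => (A *m U t (frame_map c Q x) *m B) i j).
Proof.
move=> mU i j; rewrite /measurable_on_strip.
rewrite (_ : (fun z => _) = (fun z => \sum_k \sum_l
    A i k * B l j * U z.1 (frame_map c Q z.2) k l)); last first.
  by apply/funext => z; rewrite mulmx2E.
apply: measurable_sum => k; apply: measurable_sum => l.
apply: measurable_funM => //.
pose g (z : R * borelV R d) : R * borelV R d := (z.1, frame_map c Q z.2).
have mS : measurable (`[0, 1] `*` setT : set (R * borelV R d)).
  by apply: measurableX.
apply: (@measurable_comp _ _ _ _ _ _ _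
  (fun z : R * borelV R d => U z.1 z.2 k l) _ g mS); [|exact: mU|].
  by move=> _ [[t x] [t01 _] <-].
have m2 : measurable_fun setT
    (fun z : R * borelV R d => frame_map c Q z.2 : borelV R d).
  exact: (measurableT_comp (@frame_map_measurable R d c Q) measurable_snd).
apply: measurable_funTS.
exact: (measurable_fun_pair measurable_fst m2).
Qed.

Section curve.
Variables (c : 'cV[R]_d) (Q : 'M[R]_d) (G Gs : R -> psd_measure R d).
Hypotheses (Qo : orthogonal_mx Q).
Hypothesis GGs : forall t, change_of_frame c Q (G t) (Gs t).
Implicit Types (U : R -> 'cV[R]_d -> 'M[R]_d) (u : R -> 'cV[R]_d -> 'cV[R]_d).

Let psi := frame_map (- (Q^T *m c)) Q^T.

Definition frame_mx U t y := Q *m U t (psi y) *m Q^T.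
Definition frame_vec u t y := Q *m u t (psi y).

Let QQ : Q^T *m Q = 1%:M := orthogonal_mx_tr Qo.

Lemma frame_mxK U t x :
  Q^T *m frame_mx U t (frame_map c Q x) *m Q = U t x.
Proof.
rewrite /frame_mx /psi frame_mapK// !mulmxA QQ mul1mx -mulmxA QQ.
by rewrite mulmx1.
Qed.

Lemma frame_vecK u t x : Q^T *m frame_vec u t (frame_map c Q x) = u t x.
Proof. by rewrite /frame_vec /psi frame_mapK// mulmxA QQ mul1mx. Qed.

Lemma L2norm2_frame U u :
  L2norm2 Gs (frame_mx U) (frame_vec u) = L2norm2 G U u.
Proof.
apply: eq_integral => t _; rewrite (eint_vec_frame Qo (GGs t)).
rewrite (eint_mat_frame Qo (GGs t)).
have -> : (fun x => Q^T *m frame_vec u t (frame_map c Q x)) = u t.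
  by apply/funext => x; exact: frame_vecK.
have -> // : (fun x => Q^T *m frame_mx U t (frame_map c Q x) *m Q) = U t.
by apply/funext => x; exact: frame_mxK.
Qed.

Lemma sym_on_strip_frame U : sym_on_strip U -> sym_on_strip (frame_mx U).
Proof.
by move=> sU t x t01; rewrite /sym_mx /frame_mx !trmx_mul trmxK sU ?mulmxA.
Qed.

Lemma narrow_continuous_frame : narrow_continuous G -> narrow_continuous Gs.
Proof.
move=> ncG f cf [M fM].
have cff : continuous (f \o frame_map c Q).
  by move=> x; apply: continuous_comp; [exact: frame_map_continuous|exact: cf].
have /ncG/(_ _)/subspace_continuousP cG := cff.
rewrite (_ : (fun t => _) =
  fun t => Q *m int_scal (G t) (f \o frame_map c Q) *m Q^T); last first.
  by apply/funext => t; apply: int_scal_frame => //; exists M.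
apply/subspace_continuousP => t t01.
apply: (cvg_comp _ _ (cG _ t t01) (@mulmx2_continuous _ _ _ _ _ Q Q^T _)).
by exists M => x; exact: fM.
Qed.

Lemma L2field_frame U u :
  L2field G U u -> L2field Gs (frame_mx U) (frame_vec u).
Proof.
move=> [sU mU mu nU clU]; split.
- exact: sym_on_strip_frame.
- exact: measurable_on_strip_frame.
- move=> i.
  have mu' k l : measurable_on_strip (fun t x => u t x k l) by rewrite ord1.
  have := measurable_on_strip_frame (- (Q^T *m c)) Q^T Q (1%:M : 'M[R]_1)
    mu' i 0.
  rewrite /measurable_on_strip (_ : (fun z => _) =
    (fun z : R * borelV R d => frame_vec u z.1 z.2 i 0))//.
  by apply/funext => z; rewrite mulmx1.
- by rewrite L2norm2_frame.
- move=> e e0; have [V [v [sV V1 v1 Vve]]] := clU e e0.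
  exists (frame_mx V), (frame_vec v); split.
  + exact: sym_on_strip_frame.
  + exact: C1b_frame.
  + exact: C1b_frame_vec.
  + rewrite (_ : (fun t x => _) =
      frame_mx (fun t x => U t x - V t x)); last first.
      apply/funext => t; apply/funext => x.
      by rewrite /frame_mx mulmxBr mulmxBl.
    rewrite (_ : (fun t x => frame_vec _ _ _ - _) =
        frame_vec (fun t x => u t x - v t x)); last first.
      by apply/funext => t; apply/funext => x; rewrite /frame_vec mulmxBr.
    by rewrite L2norm2_frame.
Qed.

Lemma weak_equation_frame U u :
  weak_equation G U u -> weak_equation Gs (frame_mx U) (frame_vec u).
Proof.
move=> GUu Psi sPsi Psi1 t s t01 s01.
pose Phi r x := Q^T *m Psi r (frame_map c Q x) *m Q.
have sPhi : sym_on_strip Phi.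
  by move=> r x r01; rewrite /sym_mx /Phi !trmx_mul trmxK sPsi ?mulmxA.
have := GUu Phi sPhi (C1b_frame _ _ _ _ Psi1) t s t01 s01.
rewrite !(int_tensor_frame Qo (GGs _)).
rewrite (oriented_int_eq
  (g := fun r => int_tensor (Gs r) (dt_mx Psi r)) s01 t01).
  move=> ->; apply: oriented_int_eq => // r r01.
  rewrite (int_vec_frame Qo (GGs r)) (int_mat_frame Qo (GGs r)).
  congr (_ + _).
    congr int_vec; apply/funext => x; first by rewrite frame_vecK.
    exact: div_mx_frame.
  by congr int_mat; apply/funext => x; rewrite frame_mxK.
move=> r r01; rewrite (int_tensor_frame Qo (GGs r)); congr int_tensor.
by apply/funext => x; exact: dt_mx_frame.
Qed.

Lemma admissible_frame T0 T1 T0s T1s U u :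
  change_of_frame c Q T0 T0s -> change_of_frame c Q T1 T1s ->
  admissible T0 T1 G U u ->
  admissible T0s T1s Gs (frame_mx U) (frame_vec u).
Proof.
move=> T0E T1E [ncG G0 G1 GU Gw]; split.
- exact: narrow_continuous_frame.
- move=> A mA; rewrite GGs// T0E// G0//.
  exact: measurable_frame_preimage.
- move=> A mA; rewrite GGs// T1E// G1//.
  exact: measurable_frame_preimage.
- exact: L2field_frame.
- exact: weak_equation_frame.
Qed.

End curve.

Lemma admissible_norms_frame (c : 'cV[R]_d) (Q : 'M[R]_d)
    (T0 T1 T0s T1s : psd_measure R d) :
  orthogonal_mx Q ->
  change_of_frame c Q T0 T0s -> change_of_frame c Q T1 T1s ->
  [set e | exists G U u, admissible T0 T1 G U u /\ e = L2norm2 G U u] `<=`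
  [set e | exists G U u, admissible T0s T1s G U u /\ e = L2norm2 G U u].
Proof.
move=> Qo T0E T1E _ [G [U [u [adm ->]]]].
have /choice[Gs GGs] t := change_of_frame_exists c Q (G t).
exists Gs, (frame_mx c Q U), (frame_vec c Q u).
rewrite (L2norm2_frame Qo GGs); split => //.
exact: admissible_frame adm.
Qed.

Lemma dKB_change_of_frame (c : 'cV[R]_d) (Q : 'M[R]_d)
    (T0 T1 T0s T1s : psd_measure R d) :
  orthogonal_mx Q ->
  change_of_frame c Q T0 T0s -> change_of_frame c Q T1 T1s ->
  dKB T0s T1s = dKB T0 T1.
Proof.
move=> Qo T0E T1E; rewrite /dKB; congr (ereal_inf _ `^ _)%E.
apply/seteqP; split; last exact: admissible_norms_frame Qo T0E T1E.
apply: (admissible_norms_frame (orthogonal_trmx Qo)).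
  exact: change_of_frame_sym T0E.
exact: change_of_frame_sym T1E.
Qed.

End admissible_frame.

Theorem mainTheorem8 (R : realType) (d : nat)
    (t0 : R) (cstar : R -> 'cV[R]_d) (Q : R -> 'M[R]_d)
    (Q_orth : forall t : R, orthogonal_mx (Q t))
    (T0 T1 T0star T1star : R -> psd_measure R d)
    (T0starE : forall t tstar : R, tstar = t - t0 ->
       change_of_frame (cstar t) (Q t) (T0 t) (T0star tstar))
    (T1starE : forall t tstar : R, tstar = t - t0 ->
       change_of_frame (cstar t) (Q t) (T1 t) (T1star tstar)) :
  forall t tstar : R, tstar = t - t0 ->
    dKB (T0star tstar) (T1star tstar) = dKB (T0 t) (T1 t).
Proof.
move=> t tstar tE.
by apply: dKB_change_of_frame (Q_orth t) _ _; [exact: T0starE|exact: T1starE].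
Qed.
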